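(* Let $\mathbb K$ be an algebraically closed field of characteristic $2$, and let $(\mathfrak g,\mathscr B_{\mathfrak g},\omega_{\mathfrak g})$ be an irreducible even NIS-Lie superalgebra over $\mathbb K$ equipped with a closed $\bar 1$-antisymmetric ortho-orthogonal form $\omega_{\mathfrak g}$. Suppose that $\mathfrak z(\mathfrak g)_{\bar 1}\neq\{0\}$. Then $(\mathfrak g,\mathscr B_{\mathfrak g},\omega_{\mathfrak g})$ is obtained as a $\mathscr D_{\bar 1}$-extension from a NIS-Lie superalgebra $(\mathfrak a,\mathscr B_{\mathfrak a},\omega_{\mathfrak a})$, where $\omega_{\mathfrak a}$ is a closed, $\bar 1$-antisymmetric and ortho-orthogonal form on $\mathfrak a$.
   Context: All spaces are finite-dimensional. A Lie superalgebra in characteristic $2$ is a superspace $\mathfrak g=\mathfrak g_{\bar 0}\oplus\mathfrak g_{\bar 1}$ such that $\mathfrak g_{\bar 0}$ is a Lie algebra, $\mathfrak g_{\bar 1}$ is a $\mathfrak g_{\bar 0}$-module made two-sided by symmetry, together with a squaring $s_{\mathfrak g}:\mathfrak g_{\bar 1}\to\mathfrak g_{\bar 0}$ with $s_{\mathfrak g}(\lambda x)=\lambda^2 s_{\mathfrak g}(x)$ such that $[x,y]_{\mathfrak g}:=s_{\mathfrak g}(x+y)-s_{\mathfrak g}(x)-s_{\mathfrak g}(y)$ is bilinear on $\mathfrak g_{\bar 1}$, and $[s_{\mathfrak g}(x),y]_{\mathfrak g}=[x,[x,y]_{\mathfrak g}]_{\mathfrak g}$ for $x\in\mathfrak g_{\bar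 1}$, $y\in\mathfrak g$. A derivation is a linear map $D$ with $D([x,y])=[D(x),y]+[x,D(y)]$ for $x\in\mathfrak g_{\bar 0},y\in\mathfrak g$ and $D(s_{\mathfrak g}(x))=[D(x),x]$ for $x\in\mathfrak g_{\bar 1}$; $\mathfrak{der}(\mathfrak g)_{\bar 0}$, $\mathfrak{der}(\mathfrak g)_{\bar 1}$ denote the even and odd ones. $\mathfrak z(\mathfrak g)$ is the center. NIS: a non-degenerate invariant ($\mathscr B([x,y],z)=\mathscr B(x,[y,z])$) symmetric bilinear form with $\mathscr B(x,x)=0$ for odd $x$; an even NIS-Lie superalgebra is one equipped with an even such form. A NIS-Lie superalgebra is irreducible if it cannot be decomposed into a direct sum of mutually orthogonal ideals. An even form $\omega$ is $\bar 1$-antisymmetric if it is symmetric with $\omega(x,x)=0$ for even $x$; ortho-orthogonal means even and non-degenerate; closed means $\omega([x,y],z)+\omega([z,x],y)+\omega([y,z],x)=0$ for all $x,y,z$ and $\omega(s_{\mathfrak g}(x),z)=\omega(x,[x,z])$ for $x\in\mathfrak g_{\bar 1},z\in\mathfrak g$. $\mathscr D_{\bar 1}$-extension of $(\mathfrak a,\mathscr B_{\mathfrak a},\omega_{\mathfrak a})$ (with $\mathscr B_{\mathfrak a}$ even): let $\tilde\Delta$ be the unique even invertible derivation of $\mathfrak a$ with $\omega_{\mathfrak a}=\mathscr B_{\mathfrak a}(\tilde\Delta(\cdot),\cdot)$. The data are $\mathscr D\in\mathfrak{der}(\mathfrak a)_{\bar 1}$ and $a_0\in\mathfrak a_{\bar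 0}$ with $\mathscr B_{\mathfrak a}(\mathscr D(a),b)=\mathscr B_{\mathfrak a}(a,\mathscr D(b))$ for all $a,b\in\mathfrak a$, $\mathscr D^2=\mathrm{ad}_{a_0}$, $\mathscr D(a_0)=0$; and $\lambda\in\mathbb K\setminus\{0\}$, $\mu\in\mathbb K$, $b_0\in\mathfrak a_{\bar 1}$ with $[\tilde\Delta,\mathscr D]=\lambda\mathscr D+\mathrm{ad}_{b_0}$ and $\tilde\Delta(a_0)=\mathscr D(b_0)$. Then $\mathfrak g=\mathbb Kx\oplus\mathfrak a\oplus\mathbb Kx^*$ with $x,x^*$ odd; $s_{\mathfrak g}(rx+a+tx^* )=s_{\mathfrak a}(a)+t^2a_0+t\mathscr D(a)$ for odd $rx+a+tx^*$; $[x,\mathfrak g]_{\mathfrak g}=0$, $[a,b]_{\mathfrak g}=[a,b]_{\mathfrak a}+\mathscr B_{\mathfrak a}(\mathscr D(a),b)x$, $[x^*,a]_{\mathfrak g}=\mathscr D(a)$ for $a,b\in\mathfrak a$; $\mathscr B_{\mathfrak g}|_{\mathfrak a\times\mathfrak a}=\mathscr B_{\mathfrak a}$, $\mathscr B_{\mathfrak g}(x,x^* )=1$, $\mathscr B_{\mathfrak g}(\mathfrak a,x)=\mathscr B_{\mathfrak g}(\mathfrak a,x^* )=0$, $\mathscr B_{\mathfrak g}(x,x)=\mathscr B_{\mathfrak g}(x^*,x^* )=0$; and $\omega_{\mathfrak g}=\mathscr B_{\mathfrak g}(\Delta(\cdot),\cdot)$, where $\Delta(x)=\lambda x$, $\Delta(x^*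 )=\lambda x^*+b_0+\mu x$, $\Delta(a)=\tilde\Delta(a)+\mathscr B_{\mathfrak a}(a,b_0)x$. *)

(* Defs.v *)
(* Mathematical Components *)
From HB Require Import structures.
From mathcomp Require Import all_boot all_order all_algebra.

Set Implicit Arguments.
Unset Strict Implicit.
Unset Printing Implicit Defensive.

Import GRing.Theory.
Local Open Scope ring_scope.

(* Raw operations only: the axioms are in [lie_superalgebra].  The squaring is
   a total function, but only its values on [odd_part] are meaningful.        *)
Record superalgebra (K : fieldType) := Superalgebra {
  carrier :> vectType K;
  even_part : {vspace carrier};
  odd_part : {vspace carrier};
  br : carrier -> carrier -> carrier;
  sq : carrier -> carrier
}.

Section LieSuperalgebras.

Variables (K : fieldType) (g : superalgebra K).

Implicit Types (x y z : g) (I : {vspace g}) (D : 'End(g)) (B : g -> g -> K).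

(* To be used over a field of characteristic 2.  The polar map of [sq] is
   required to be the restriction of the bilinear [br] to the odd part.       *)
Record lie_superalgebra : Prop := LieSuperalgebra {
  grading_full : (even_part g + odd_part g)%VS = fullv;
  grading_direct : (even_part g :&: odd_part g)%VS = 0%VS;
  br_bilinear : bilinear_for *:%R *:%R (@br K g);
  br_even_even : {in even_part g &, forall x y, br x y \in even_part g};
  br_alternating : {in even_part g, forall x, br x x = 0};
  br_jacobi : {in even_part g & &, forall x y z,
    br x (br y z) + br y (br z x) + br z (br x y) = 0};
  br_even_odd : {in even_part g & odd_part g, forall x y,
    br x y \in odd_part g};
  br_module : forall x y z,
    x \in even_part g -> y \in even_part g -> z \in odd_part g ->
    br (br x y) z = br x (br y z) - br y (br x z);
  br_odd_even : {in even_part g & odd_part g, forall x y, br y x = br x y};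
  sq_even : {in odd_part g, forall x, sq x \in even_part g};
  sq_scale : forall (c : K) x, x \in odd_part g ->
    sq (c *: x) = c ^+ 2 *: sq x;
  br_odd_odd : {in odd_part g &, forall x y,
    br x y = sq (x + y) - sq x - sq y};
  br_sq : forall x y, x \in odd_part g -> br (sq x) y = br x (br x y)
}.

Definition central x : Prop := forall y, br x y = 0.

Record ideal I : Prop := Ideal {
  ideal_graded : I = (I :&: even_part g + I :&: odd_part g)%VS;
  ideal_br : forall x y, y \in I -> br x y \in I;
  ideal_sq : forall x, x \in I -> x \in odd_part g -> sq x \in I
}.

Record derivation D : Prop := Derivation {
  der_br : forall x y, x \in even_part g ->
    D (br x y) = br (D x) y + br x (D y);
  der_sq : {in odd_part g, forall x, D (sq x) = br (D x) x}
}.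

Definition even_map D : Prop :=
  {in even_part g, forall x, D x \in even_part g} /\
  {in odd_part g, forall x, D x \in odd_part g}.

Definition odd_map D : Prop :=
  {in even_part g, forall x, D x \in odd_part g} /\
  {in odd_part g, forall x, D x \in even_part g}.

Definition even_form B : Prop :=
  {in even_part g & odd_part g, forall x y, B x y = 0 /\ B y x = 0}.

(* For symmetric forms, as here, left and right non-degeneracy agree. *)
Definition nondegenerate_form B : Prop :=
  forall x, (forall y, B x y = 0) -> x = 0.

Record NIS B : Prop := NISForm {
  NIS_bilinear : bilinear_for *%R *%R B;
  NIS_nondegenerate : nondegenerate_form B;
  NIS_invariant : forall x y z, B (br x y) z = B x (br y z);
  NIS_symmetric : forall x y, B x y = B y x;
  NIS_odd_isotropic : {in odd_part g, forall x, B x x = 0}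
}.

Definition even_NIS B : Prop := NIS B /\ even_form B.

Definition irreducible B : Prop :=
  forall I J : {vspace g}, ideal I -> ideal J ->
    (I + J)%VS = fullv -> (I :&: J)%VS = 0%VS ->
    {in I & J, forall x y, B x y = 0} ->
  I = 0%VS \/ J = 0%VS.

Definition one_antisymmetric (om : g -> g -> K) : Prop :=
  (forall x y, om x y = om y x) /\ {in even_part g, forall x, om x x = 0}.

Definition ortho_orthogonal (om : g -> g -> K) : Prop :=
  even_form om /\ nondegenerate_form om.

Definition closed_form (om : g -> g -> K) : Prop :=
  (forall x y z, om (br x y) z + om (br z x) y + om (br y z) x = 0) /\
  (forall x z, x \in odd_part g -> om (sq x) z = om x (br x z)).

Record closed_one_antisym_ortho_orthogonal (om : g -> g -> K) : Prop := {
  om_bilinear : bilinear_for *%R *%R om;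
  om_closed : closed_form om;
  om_antisymmetric : one_antisymmetric om;
  om_ortho_orthogonal : ortho_orthogonal om
}.

End LieSuperalgebras.

Arguments lie_superalgebra {K} g.

(* The non-degeneracy of [Ba] makes [Dt] unique. *)
Record D1_data (K : fieldType) (a : superalgebra K) (Ba oma : a -> a -> K)
    (Dt D : 'End(a)) (a0 b0 : a) (lam mu : K) : Prop := D1Data {
  Dt_even : even_map Dt;
  Dt_derivation : derivation Dt;
  Dt_invertible : bijective Dt;
  Dt_form : forall u v : a, oma u v = Ba (Dt u) v;
  D_odd : odd_map D;
  D_derivation : derivation D;
  D_selfadjoint : forall u v : a, Ba (D u) v = Ba u (D v);
  a0_even : a0 \in even_part a;
  D_square : forall u : a, D (D u) = br a0 u;
  D_a0 : D a0 = 0;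
  lam_neq0 : lam != 0;
  b0_odd : b0 \in odd_part a;
  D_commutator : forall u : a, Dt (D u) - D (Dt u) = lam *: D u + br b0 u;
  Dt_a0 : Dt a0 = D b0
}.

Section D1Extension.

Variables (K : fieldType) (a : superalgebra K) (Ba : a -> a -> K).
Variables (Dt D : 'End(a)) (a0 b0 : a) (lam mu : K).

(* The triple (r, u, t) stands for r x + u + t x^*. *)
Definition D1_space : vectType K := (K^o * a * K^o)%type.

Definition D1_x : D1_space := (1, 0, 0).
Definition D1_xstar : D1_space := (0, 0, 1).
Definition D1_incl (u : a) : D1_space := (0, u, 0).

Definition D1_even : {vspace D1_space} :=
  (linfun D1_incl @: even_part a)%VS.

Definition D1_odd : {vspace D1_space} :=
  (<[D1_x]> + linfun D1_incl @: odd_part a + <[D1_xstar]>)%VS.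

Lemma D1_incl_is_linear : linear D1_incl.
Proof. by move=> c u v; congr (_, _, _); rewrite /= scaler0 addr0. Qed.

HB.instance Definition _ :=
  GRing.isLinear.Build K a D1_space _ D1_incl D1_incl_is_linear.

Lemma mem_D1_even (r t : K^o) (u : a) :
  ((r, u, t) \in D1_even) = [&& r == 0, u \in even_part a & t == 0].
Proof.
apply/memv_imgP/and3P => [[v v0]|[/eqP-> u0 /eqP->]].
  by rewrite lfunE => -[-> -> ->]; rewrite !eqxx.
by exists u; rewrite ?lfunE.
Qed.

Lemma mem_D1_odd (r t : K^o) (u : a) :
  ((r, u, t) \in D1_odd) = (u \in odd_part a).
Proof.
have split_rut (r' t' : K^o) (v : a) :
    (r', v, t') = r' *: D1_x + linfun D1_incl v + t' *: D1_xstar :> D1_space.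
  rewrite lfunE; congr (_, _, _) => /=.
  - by rewrite scaler0 !addr0; exact/esym/mulr1.
  - by rewrite !scaler0 add0r addr0.
  - by rewrite scaler0 !add0r; exact/esym/mulr1.
apply/idP/idP => [|u1].
  case/memv_addP=> p /memv_addP[q /vlineP[c ->] [w /memv_imgP[v v1 ->] ->]].
  by case=> z /vlineP[d ->]; rewrite -split_rut => -[_ -> _].
rewrite split_rut !memv_add ?memv_img //; apply/vlineP; first by exists r.
by exists t.
Qed.

(* In characteristic 2, [u, x^*] = [x^*, u] = D u and [x^*, x^*] = 0. *)
Definition D1_br (p q : D1_space) : D1_space :=
  let: (r, u, t) := p in let: (r', v, t') := q in
  (Ba (D u) v, br u v + t *: D v + t' *: D u, 0).

Definition D1_sq (p : D1_space) : D1_space :=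
  let: (r, u, t) := p in (0, sq u + t ^+ 2 *: a0 + t *: D u, 0).

Definition D1_extension : superalgebra K :=
  @Superalgebra K D1_space D1_even D1_odd D1_br D1_sq.

Definition D1_form (p q : D1_extension) : K :=
  let: (r, u, t) := p in let: (r', v, t') := q in
  Ba u v + r * t' + t * r'.

Definition D1_Delta (p : D1_extension) : D1_extension :=
  let: (r, u, t) := p in
  (lam * r + Ba u b0 + mu * t, Dt u + t *: b0, lam * t).

Definition D1_omega (p q : D1_extension) : K := D1_form (D1_Delta p) q.

End D1Extension.

Record isometric_isomorphism (K : fieldType) (g h : superalgebra K)
    (Bg omg : g -> g -> K) (Bh omh : h -> h -> K) (f : 'Hom(g, h)) : Prop := {
  iso_bij : bijective f;
  iso_even : (f @: even_part g)%VS = even_part h;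
  iso_odd : (f @: odd_part g)%VS = odd_part h;
  iso_br : forall x y : g, f (br x y) = br (f x) (f y);
  iso_sq : {in odd_part g, forall x, f (sq x) = sq (f x)};
  iso_form : forall x y : g, Bh (f x) (f y) = Bg x y;
  iso_omega : forall x y : g, omh (f x) (f y) = omg x y
}.

Definition is_D1_extension_of (K : fieldType)
    (g : superalgebra K) (Bg omg : g -> g -> K)
    (a : superalgebra K) (Ba oma : a -> a -> K) : Prop :=
  exists (Dt D : 'End(a)) (a0 b0 : a) (lam mu : K),
    D1_data Ba oma Dt D a0 b0 lam mu /\
    exists f : 'Hom(g, D1_extension Ba D a0),
      isometric_isomorphism Bg omg
        (@D1_form K a Ba D a0) (@D1_omega K a Ba Dt D a0 b0 lam mu) f.

(* Main.v *)
From HB Require Import structures.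
Require Import Defs.
From mathcomp Require Import all_boot all_order all_algebra.

Set Implicit Arguments.
Unset Strict Implicit.
Unset Printing Implicit Defensive.

Import GRing.Theory.
Local Open Scope ring_scope.

(** Write [om = B (Delta _) _].  The axioms on [om] imply that [Delta] is
    an even, invertible, [B]-selfadjoint derivation of [g] ([Delta_br],
    [Delta_sq], [Delta_inj], [Delta_even]).  A derivation preserves the center,
    so [Delta] acts on the odd part of the center, which is nonzero; over an
    algebraically closed field it has there an eigenvector [x], say
    [Delta x = lam *: x], and [lam != 0] because [Delta] is injective.  The same
    injectivity kills the square of [x]: it satisfies
    [Delta (sq x) = br (Delta x) x = 0].

    Being odd, [x] is isotropic, and it pairs to [1] with some odd [xs], which
    is isotropic too.  Hence [g] is the orthogonal sum of the hyperbolic plane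
    spanned by [x] and [xs] and of its orthogonal [a].  Invariance of [B] and
    centrality of [x] put all brackets in the orthogonal of [x], which is
    [K x + a]; so projecting the operations of [g] to [a] only ever discards a
    multiple of the central vector [x].  This is why every identity of [g]
    survives in [a] (the lemmas [reduction_lie], [reduction_NIS] and
    [reduction_omega_symplectic]).

    The data of the extension are then read off from [xs]: [D] is the bracket
    with [xs], [a0] is the square of [xs], and [b0] and [mu] are the components
    of [Delta xs] on [a] and on [x].  The equations they satisfy
    ([reduction_D1_data]) are the Jacobi identity, the axiom on squares and the
    fact that [Delta] is a derivation, all applied to [xs].  Splitting a vector
    into its components on [x], [a] and [xs] is the required isomorphism
    ([split_map_iso]). *)

(** * Linear algebra *)

Section BilinearFor.

Variables (R : nzRingType) (U U' : lmodType R) (V : zmodType).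
Variables (s s' : GRing.Scale.law R V) (f : U -> U' -> V).
Hypothesis bf : bilinear_for s s' f.

Let fl (w : U') : {linear U -> V | s} :=
  HB.pack (f^~ w) (GRing.isLinear.Build R U V s (f^~ w) (bf.1 w)).
Let fr (u : U) : {linear U' -> V | s'} :=
  HB.pack (f u) (GRing.isLinear.Build R U' V s' (f u) (bf.2 u)).

Lemma bilinDl u v w : f (u + v) w = f u w + f v w.
Proof. exact: (linearD (fl w)). Qed.

Lemma bilinDr u v w : f u (v + w) = f u v + f u w.
Proof. exact: (linearD (fr u)). Qed.

Lemma bilinZl c u w : f (c *: u) w = s c (f u w).
Proof. exact: (linearZ_LR (fl w)). Qed.

Lemma bilinZr c u w : f u (c *: w) = s' c (f u w).
Proof. exact: (linearZ_LR (fr u)). Qed.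

Lemma bilin0l w : f 0 w = 0.
Proof. exact: (linear0 (fl w)). Qed.

Lemma bilin0r u : f u 0 = 0.
Proof. exact: (linear0 (fr u)). Qed.

Lemma bilin_sumr u n (F : 'I_n -> U') :
  f u (\sum_i F i) = \sum_i f u (F i).
Proof. exact: (raddf_sum (fr u)). Qed.

End BilinearFor.

Section LinearAlgebra.

Variable K : fieldType.

Lemma linfun_linearE (U V : vectType K) (f : U -> V) :
  linear f -> linfun f =1 f.
Proof.
move=> lf u; pose F : {linear U -> V} :=
  HB.pack f (GRing.isLinear.Build K U V *:%R f lf).
exact: (lfunE F).
Qed.

Lemma inj_end_bij (V : vectType K) (f : 'End(V)) : injective f -> bijective f.
Proof.
move=> /lker0P kf; exists (f^-1)%VF.
  exact: lker0_lfunK.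
exact: lker0_lfunVK.
Qed.

(** Both forms are encoded by their Gram rows against a fixed basis.  The Gram
    row map of [B] is injective between spaces of equal dimension, so composing
    its inverse with the Gram row map of [om] gives [f]. *)
Lemma nondegenerate_representation (V : vectType K) (B om : V -> V -> K) :
    bilinear_for *%R *%R B -> bilinear_for *%R *%R om ->
    (forall u, (forall v, B u v = 0) -> u = 0) ->
  exists f : 'End(V), forall u v, B (f u) v = om u v.
Proof.
move=> bB bo nB; pose n : nat := \dim {: V}; pose e := vbasis {: V}.
pose G (C : V -> V -> K) u : 'rV[K]_n := \row_i C u e`_i.
have linG C : bilinear_for *%R *%R C -> linear (G C).
  by move=> bC c u v; apply/rowP=> i; rewrite !mxE (bilinDl bC) (bilinZl bC).
have ext (C : V -> V -> K) u v : bilinear_for *%R *%R C ->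
    C u v = \sum_(i < n) coord e i v * G C u ord0 i.
  move=> bC; rewrite {1}(coord_vbasis (memvf v)) (bilin_sumr bC).
  by apply: eq_bigr => i _; rewrite (bilinZr bC) mxE.
pose F := linfun (G B); have FE := linfun_linearE (linG _ bB).
have kF : lker F == 0%VS.
  apply/lker0P=> u v; rewrite !FE => Guv.
  apply/eqP; rewrite -subr_eq0; apply/eqP/nB => w.
  rewrite (ext _ _ _ bB) -[u - v]addrC -scaleN1r (linG _ bB) Guv.
  by rewrite scaleN1r addNr big1 // => i _; rewrite mxE mulr0.
have surj : limg F = fullv.
  apply/eqP; rewrite eqEdim subvf limg_dim_eq ?(eqP kF) ?capv0 //.
  by rewrite dimvf dim_matrix; apply: eq_leq; apply: mul1n.
exists (F^-1 \o linfun (G om))%VF => u v.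
rewrite (ext _ _ _ bB) (ext _ _ _ bo) -FE comp_lfunE.
by rewrite limg_lfunVK ?surj ?memvf // (linfun_linearE (linG _ bo)).
Qed.

End LinearAlgebra.

(** The matrix [A] of the restriction of [f] to [U], in a basis of [U] and
    acting on row vectors, has an eigenvector since its characteristic polynomial is
    not constant; it gives the coordinates of [u]. *)
Lemma stable_eigenvector (K : closedFieldType) (V : vectType K)
    (f : 'End(V)) (U : {vspace V}) :
    U != 0%VS -> (forall u, u \in U -> f u \in U) ->
  exists2 u, (u \in U) && (u != 0) & exists a, f u = a *: u.
Proof.
move=> U0 fU; have n_gt0 : (0 < \dim U)%N by rewrite lt0n dimv_eq0.
pose e := vbasis U.
have eU (i : 'I_(\dim U)) : e`_i \in U.
  by rewrite vbasis_mem // mem_nth // size_tuple.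
pose A : 'M[K]_(\dim U) := \matrix_(i, j) coord e j (f e`_i).
have /closed_rootP[a] : size (char_poly A) != 1%N.
  by rewrite size_char_poly eqSS -lt0n.
rewrite -eigenvalue_root_char => /eigenvalueP[v vA v0].
exists (\sum_i v ord0 i *: e`_i).
  apply/andP; split; first by apply: rpred_sum => i _; rewrite rpredZ.
  apply: contraNneq v0 => w0; apply/eqP/rowP=> i; rewrite mxE.
  have /freeP/(_ (fun i => v ord0 i)) := basis_free (vbasisP U).
  by apply.
exists a; rewrite linear_sum scaler_sumr /=.
under eq_bigr => i _.
  rewrite linearZ /= (coord_vbasis (fU _ (eU i))) scaler_sumr.
  under eq_bigr => j _ do rewrite scalerA.
  over.
rewrite exchange_big; apply: eq_bigr => j _ /=; rewrite -scaler_suml scalerA.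
congr (_ *: _); have /rowP/(_ j) := vA; rewrite !mxE => <-.
by apply: eq_bigr => i _; rewrite mxE.
Qed.

(** * Lie superalgebras in characteristic 2 *)

Section CharacteristicTwo.

Variables (K : fieldType) (charK : 2%N \in [pchar K]).

Lemma addvv_pchar2 (V : lmodType K) (v : V) : v + v = 0.
Proof. by rewrite -mulr2n -scaler_nat (pcharf0 charK) scale0r. Qed.

Lemma oppv_pchar2 (V : lmodType K) (v : V) : - v = v.
Proof. by apply/esym/eqP; rewrite -addr_eq0 addvv_pchar2. Qed.

Section LieIdentities.

Variables (g : superalgebra K) (lie_g : lie_superalgebra g).
Implicit Types x y z : g.

Lemma brDl x y z : br (x + y) z = br x z + br y z.
Proof. exact: bilinDl (br_bilinear lie_g) x y z. Qed.

Lemma brDr x y z : br x (y + z) = br x y + br x z.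
Proof. exact: bilinDr (br_bilinear lie_g) x y z. Qed.

Lemma brZl c x y : br (c *: x) y = c *: br x y.
Proof. exact: bilinZl (br_bilinear lie_g) c x y. Qed.

Lemma brZr c x y : br x (c *: y) = c *: br x y.
Proof. exact: bilinZr (br_bilinear lie_g) c x y. Qed.

Lemma br0r x : br x 0 = 0.
Proof. exact: bilin0r (br_bilinear lie_g) x. Qed.

Lemma parity_split x :
  exists e o, [/\ e \in even_part g, o \in odd_part g & x = e + o].
Proof.
have /memv_addP[e e0 [o o1 ->]] : x \in (even_part g + odd_part g)%VS.
  by rewrite (grading_full lie_g) memvf.
by exists e, o.
Qed.

Lemma parity_disjoint x : x \in even_part g -> x \in odd_part g -> x = 0.
Proof.
move=> x0 x1; apply/eqP.
by rewrite -memv0 -(grading_direct lie_g) memv_cap x0.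
Qed.

Lemma sq0 : sq (0 : g) = 0.
Proof.
by have := sq_scale lie_g 0 (mem0v (odd_part g)); rewrite expr0n !scale0r.
Qed.

Lemma sqD x y : x \in odd_part g -> y \in odd_part g ->
  sq (x + y) = sq x + sq y + br x y.
Proof.
move=> x1 y1; rewrite (br_odd_odd lie_g) //.
by rewrite -[sq (x + y) - _ - _]addrA -opprD [RHS]addrC subrK.
Qed.

Lemma br_odd_self x : x \in odd_part g -> br x x = 0.
Proof.
move=> x1.
rewrite (br_odd_odd lie_g) // addvv_pchar2 sq0 sub0r -opprD.
by rewrite addvv_pchar2 oppr0.
Qed.

Lemma br_even_self x : x \in even_part g -> br x x = 0.
Proof. exact: (br_alternating lie_g). Qed.

(** In each parity the bracket is alternating, hence symmetric in
    characteristic 2; between parities symmetry is an axiom. *)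
Lemma br_sym x y : br x y = br y x.
Proof.
have self (u v : g) : br u u = 0 -> br v v = 0 -> br (u + v) (u + v) = 0 ->
    br u v = br v u.
  move=> uu vv; rewrite brDl !brDr uu vv add0r addr0.
  by move/eqP; rewrite addr_eq0 oppv_pchar2 => /eqP.
have [e [o [e0 o1 ->]]] := parity_split x.
have [e' [o' [e0' o1' ->]]] := parity_split y.
rewrite !brDl !brDr (br_odd_even lie_g e0' o1).
rewrite (br_odd_even lie_g e0 o1') (self e e') ?br_even_self ?memvD //.
rewrite (self o o') ?br_odd_self ?memvD //.
by rewrite addrACA.
Qed.

(** This is the axiom [br (sq x) z = br x (br x z)], polarized in [x]. *)
Lemma br_polarized x y z : x \in odd_part g -> y \in odd_part g ->
  br (br x y) z = br x (br y z) + br y (br x z).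
Proof.
move=> x1 y1; have := br_sq lie_g z (memvD x1 y1).
rewrite sqD // !brDl !brDr !(br_sq lie_g) // => E.
apply: (addrI (br x (br x z) + br y (br y z))); rewrite {}E.
by rewrite [LHS](AC (2*2) ((1*4)*(2*3))).
Qed.

(** In characteristic 2 the Jacobi identity carries no signs, whatever the
    parities.  The cyclic sum [J] is invariant under cyclic permutation, and
    two of three homogeneous vectors always have the same parity, so it is
    enough to treat two even vectors (the axioms on the even part and on the
    module) and two odd ones ([br_polarized]). *)
Lemma br_leibniz x y z : br x (br y z) = br (br x y) z + br y (br x z).
Proof.
pose J (u v w : g) := br u (br v w) + br v (br w u) + br w (br u v).
suff J0 : J x y z = 0.
  apply/eqP; rewrite -[_ + br y _](oppv_pchar2 (V := g)) -addr_eq0 -J0 /J.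
  by rewrite (br_sym z x) (br_sym (br x y) z) -addrA [br z _ + _]addrC.
have cyc u v w : J u v w = J v w u by rewrite /J -addrA addrC.
have JD u u' v w : J (u + u') v w = J u v w + J u' v w.
  by rewrite /J !(brDl, brDr) [LHS](AC ((2*2)*2) ((1*3*5)*(2*4*6))).
have ee u v w : u \in even_part g -> v \in even_part g -> J u v w = 0.
  move=> u0 v0; have [e [o [e0 o1 ->]]] := parity_split w.
  rewrite -[J u v _]cyc JD [J e u v]cyc [J o u v]cyc.
  rewrite {1}/J (br_jacobi lie_g) // add0r.
  rewrite /J (br_sym o u) (br_sym o) (br_module lie_g) // oppv_pchar2.
  exact: addvv_pchar2.
have oo u v w : u \in odd_part g -> v \in odd_part g -> J u v w = 0.
  move=> u1 v1; rewrite /J (br_sym w (br _ _)) br_polarized // (br_sym w u).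
  exact: addvv_pchar2.
have eo u v w : u \in even_part g -> v \in odd_part g -> J u v w = 0.
  move=> u0 v1; have [e [o [e0 o1 ->]]] := parity_split w.
  rewrite -[J u v _]cyc JD (ee e u) // add0r.
  by rewrite [J o u v]cyc [J u v o]cyc oo.
have even_first u v w : u \in even_part g -> J u v w = 0.
  move=> u0; have [e [o [e0 o1 ->]]] := parity_split v.
  by rewrite [LHS]cyc JD -[J e w u]cyc -[J o w u]cyc ee // eo // addr0.
have [e [o [e0 o1 ->]]] := parity_split x.
have [e' [o' [e0' o1' ->]]] := parity_split y.
rewrite JD even_first // add0r cyc JD even_first // add0r.
by rewrite -cyc oo.
Qed.

End LieIdentities.

Section EvenForm.

Variables (g : superalgebra K) (B : g -> g -> K).
Hypothesis bilB : bilinear_for *%R *%R B.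
Implicit Types x y z : g.

Lemma formDl x y z : B (x + y) z = B x z + B y z.
Proof. exact: bilinDl bilB x y z. Qed.

Lemma formDr x y z : B x (y + z) = B x y + B x z.
Proof. exact: bilinDr bilB x y z. Qed.

Lemma formZl c x y : B (c *: x) y = c * B x y.
Proof. exact: bilinZl bilB c x y. Qed.

Lemma formZr c x y : B x (c *: y) = c * B x y.
Proof. exact: bilinZr bilB c x y. Qed.

Lemma form0l x : B 0 x = 0.
Proof. exact: bilin0l bilB x. Qed.

End EvenForm.

(** * The derivation relating the two forms *)

Section SymplecticDerivation.

Variables (g : superalgebra K) (B om : g -> g -> K).
Hypothesis lie_g : lie_superalgebra g.
Hypothesis NIS_B : even_NIS B.
Hypothesis om_g : closed_one_antisym_ortho_orthogonal om.
Variable Delta : 'End(g).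
Hypothesis DeltaE : forall u v : g, B (Delta u) v = om u v.
Implicit Types u v w : g.

Let bilB := NIS_bilinear NIS_B.1.

Lemma form_inj u v : (forall w, B u w = B v w) -> u = v.
Proof.
move=> uv; apply/eqP; rewrite -[v](oppv_pchar2 (V := g)) -addr_eq0.
apply/eqP/(NIS_nondegenerate NIS_B.1) => w.
by rewrite (formDl bilB) uv addrr_pchar2.
Qed.

Lemma Delta_selfadjoint u v : B (Delta u) v = B u (Delta v).
Proof.
by rewrite [RHS](NIS_symmetric NIS_B.1) !DeltaE (om_antisymmetric om_g).1.
Qed.

(** Moving [Delta] and the brackets across [B] turns each term of the cocycle
    condition on [om] into [B _ w]. *)
Lemma Delta_br u v : Delta (br u v) = br (Delta u) v + br u (Delta v).
Proof.
apply: form_inj => w; rewrite (formDl bilB).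
have inv := NIS_invariant NIS_B.1; have sym := NIS_symmetric NIS_B.1.
have /eqP := (om_closed om_g).1 u v w.
rewrite -addrA addr_eq0 oppr_pchar2 // -DeltaE => /eqP->.
rewrite addrC; congr (_ + _).
  by rewrite (om_antisymmetric om_g).1 -DeltaE -inv.
rewrite (om_antisymmetric om_g).1 -DeltaE sym inv sym.
by rewrite (br_sym lie_g u) inv; congr (B _ _).
Qed.

Lemma Delta_sq u : u \in odd_part g -> Delta (sq u) = br (Delta u) u.
Proof.
move=> u1; apply: form_inj => w.
by rewrite DeltaE (om_closed om_g).2 // -DeltaE (NIS_invariant NIS_B.1).
Qed.

Lemma Delta_inj : injective Delta.
Proof.
move=> u v uv; apply/eqP; rewrite -subr_eq0; apply/eqP.
apply: (om_ortho_orthogonal om_g).2 => w.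
by rewrite -DeltaE linearB /= uv subrr (form0l bilB).
Qed.

(** Since [B] is even, the odd component of [u] is orthogonal to the even part;
    if [u] is also orthogonal to the odd part, that component vanishes. *)
Lemma even_of_orth_odd u :
  (forall v, v \in odd_part g -> B u v = 0) -> u \in even_part g.
Proof.
move=> uo; have [e [o [e0 o1 ue]]] := parity_split lie_g u.
suff o0 : o = 0 by rewrite ue o0 addr0.
apply: form_inj => w; rewrite (form0l bilB).
have [e' [o' [e0' o1' ->]]] := parity_split lie_g w.
rewrite (formDr bilB) (NIS_B.2 _ _ e0' o1).2 add0r.
by rewrite -(uo o' o1') ue (formDl bilB) (NIS_B.2 _ _ e0 o1').1 add0r.
Qed.

Lemma odd_of_orth_even u :
  (forall v, v \in even_part g -> B u v = 0) -> u \in odd_part g.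
Proof.
move=> uo; have [e [o [e0 o1 ue]]] := parity_split lie_g u.
suff o0 : e = 0 by rewrite ue o0 add0r.
apply: form_inj => w; rewrite (form0l bilB).
have [e' [o' [e0' o1' ->]]] := parity_split lie_g w.
rewrite (formDr bilB) (NIS_B.2 _ _ e0 o1').1 addr0.
by rewrite -(uo e' e0') ue (formDl bilB) (NIS_B.2 _ _ e0' o1).2 addr0.
Qed.

Lemma Delta_even : even_map Delta.
Proof.
split=> u u0.
  apply: even_of_orth_odd => v v1.
  by rewrite DeltaE ((om_ortho_orthogonal om_g).1 u v _ _).1.
apply: odd_of_orth_even => v v1.
by rewrite DeltaE ((om_ortho_orthogonal om_g).1 v u _ _).2.
Qed.

End SymplecticDerivation.

(** The center is the kernel of the adjoint map, hence a subspace. *)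
Lemma odd_center_vspace (g : superalgebra K) (lie_g : lie_superalgebra g) :
  exists Z : {vspace g},
    forall z, z \in Z <-> z \in odd_part g /\ central z.
Proof.
have ad_lin (z : g) : linear (br z) := (br_bilinear lie_g).2 z.
pose ad (z : g) : 'End(g) := linfun (br z).
have adE z v : ad z v = br z v := linfun_linearE (ad_lin z) v.
have lin_ad : linear ad.
  move=> c u v; apply/lfunP=> w; rewrite !lfunE /= lfunE /= !adE.
  by rewrite (brDl lie_g) (brZl lie_g).
exists (odd_part g :&: lker (linfun ad))%VS => z.
rewrite memv_cap memv_ker (linfun_linearE lin_ad).
split=> [/andP[z1 /eqP z0]|[z1 z0]].
  by split=> // v; rewrite -adE z0 lfunE.
by rewrite z1; apply/eqP/lfunP=> v; rewrite adE z0 lfunE.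
Qed.

(** Only a vector of the same parity can pair with [x], since the form is
    even: the odd component of any partner of [x] does the job. *)
Lemma odd_partner (g : superalgebra K) (B : g -> g -> K) (x : g) :
    lie_superalgebra g -> even_NIS B -> x \in odd_part g -> x != 0 ->
  exists2 y, y \in odd_part g & B x y != 0.
Proof.
move=> lie_g NIS_B x1 x0; have bilB := NIS_bilinear NIS_B.1.
have BxE : linfun (B x : g -> K^o) =1 B x.
  by apply: linfun_linearE => c u v; apply: (bilB.2 x).
have img0 : limg (linfun (B x : g -> K^o)) != 0%VS.
  apply: contra_neq x0 => img0; apply: (NIS_nondegenerate NIS_B.1) => y.
  have := memv_img (linfun (B x : g -> K^o)) (memvf y).
  by rewrite img0 memv0 BxE => /eqP.
have /memv_imgP[y _ By] := memv_pick (limg (linfun (B x : g -> K^o))).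
have [e [o [e0 o1 ye]]] := parity_split lie_g y; exists o => //.
move: img0; rewrite -vpick0 By BxE ye (formDr bilB).
by rewrite (NIS_B.2 _ _ e0 x1).2 add0r.
Qed.

(** * The algebra on the orthogonal of the hyperbolic plane *)

Section Reduction.

Variables (g : superalgebra K) (B om : g -> g -> K).
Hypothesis lie_g : lie_superalgebra g.
Hypothesis NIS_B : even_NIS B.
Hypothesis om_g : closed_one_antisym_ortho_orthogonal om.
Variable Delta : 'End(g).
Hypothesis DeltaE : forall u v : g, B (Delta u) v = om u v.
Variables (x xs : g) (lam : K).
Hypothesis x_odd : x \in odd_part g.
Hypothesis x_central : central x.
Hypothesis Delta_x : Delta x = lam *: x.
Hypothesis lam_neq0 : lam != 0.
Hypothesis xs_odd : xs \in odd_part g.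
Hypothesis B_x_xs : B x xs = 1.
Implicit Types u v w : g.

Let bilB := NIS_bilinear NIS_B.1.
Let symB := NIS_symmetric NIS_B.1.
Let invB := NIS_invariant NIS_B.1.
Let BDl := formDl bilB.
Let BDr := formDr bilB.
Let BZl := formZl bilB.
Let BZr := formZr bilB.
Let bDl := brDl lie_g.
Let bDr := brDr lie_g.
Let bZl := brZl lie_g.
Let bZr := brZr lie_g.

Let Bxx : B x x = 0. Proof. exact: NIS_odd_isotropic NIS_B.1 x x_odd. Qed.
Let Bss : B xs xs = 0. Proof. exact: NIS_odd_isotropic NIS_B.1 xs xs_odd. Qed.
Let Bsx : B xs x = 1. Proof. by rewrite symB. Qed.

Let br_x u : br u x = 0.
Proof. by rewrite br_sym. Qed.

(* By invariance, brackets are orthogonal to central elements. *)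
Let Bbrx u v : B (br u v) x = 0.
Proof. by rewrite invB br_x symB (form0l bilB). Qed.

Let B_even_odd u v : u \in even_part g -> v \in odd_part g -> B u v = 0.
Proof. by move=> u0 v1; rewrite (NIS_B.2 _ _ u0 v1).1. Qed.

(* [Delta (sq x) = lam *: br x x = 0], and [Delta] is injective. *)
Let sqx : sq x = 0.
Proof.
apply: (Delta_inj NIS_B om_g DeltaE).
by rewrite (Delta_sq NIS_B om_g DeltaE) // linear0 br_x.
Qed.

Let perp_fun u : K^o * K^o := (B u x, B u xs).

Let perp_fun_linear : linear perp_fun.
Proof. by move=> c u v; rewrite /perp_fun !BDl !BZl. Qed.

Definition hyperbolic_perp : {vspace g} := lker (linfun perp_fun).

Lemma mem_hyperbolic_perp u :
  (u \in hyperbolic_perp) = (B u x == 0) && (B u xs == 0).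
Proof. by rewrite memv_ker (linfun_linearE perp_fun_linear). Qed.

Let a := subvs_of hyperbolic_perp.

(** Orthogonal projection onto the orthogonal of the hyperbolic plane: the
    coefficient of [x] is read by pairing with [xs] and conversely, and the
    signs disappear in characteristic 2. *)
Definition perp_part u : g := u + B u xs *: x + B u x *: xs.

Lemma perp_part_linear : linear perp_part.
Proof.
move=> c u v; rewrite /perp_part !BDl !BZl !scalerDl !scalerDr !scalerA.
by rewrite [LHS](AC ((2*2)*2) ((1*3*5)*(2*4*6))).
Qed.

Lemma perp_part_in u : perp_part u \in hyperbolic_perp.
Proof.
rewrite mem_hyperbolic_perp /perp_part !BDl !BZl Bxx Bss Bsx B_x_xs.
by rewrite !mulr0 !mulr1 !addr0 !addrr_pchar2 // eqxx.
Qed.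

Definition pr u : a := vsproj hyperbolic_perp (perp_part u).

Lemma pr_linear : linear pr.
Proof. by move=> c u v; rewrite /pr perp_part_linear linearP. Qed.

HB.instance Definition _ := GRing.isLinear.Build K g a *:%R pr pr_linear.

Lemma val_pr u : vsval (pr u) = u + B u xs *: x + B u x *: xs.
Proof. by rewrite vsprojK ?perp_part_in. Qed.

Let B_val_x (u : a) : B (vsval u) x = 0.
Proof. by have := subvsP u; rewrite mem_hyperbolic_perp => /andP[/eqP]. Qed.

Let B_val_xs (u : a) : B (vsval u) xs = 0.
Proof. by have := subvsP u; rewrite mem_hyperbolic_perp => /andP[_ /eqP]. Qed.

Lemma pr_val (u : a) : pr (vsval u) = u.
Proof.
by apply: val_inj; rewrite /= val_pr B_val_x B_val_xs !scale0r !addr0.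
Qed.

Let pr_x : pr x = 0.
Proof.
apply: val_inj; rewrite /= val_pr Bxx B_x_xs scale0r scale1r addr0.
exact: addvv_pchar2.
Qed.

Let pr_xs : pr xs = 0.
Proof.
apply: val_inj; rewrite /= val_pr Bsx Bss scale0r scale1r addr0.
exact: addvv_pchar2.
Qed.

Lemma B_pr u (v : a) : B (vsval (pr u)) (vsval v) = B u (vsval v).
Proof.
rewrite val_pr !BDl !BZl (symB x) (symB xs) B_val_x B_val_xs.
by rewrite !mulr0 !addr0.
Qed.

Lemma split_val_pr u : u = B u xs *: x + vsval (pr u) + B u x *: xs.
Proof.
rewrite val_pr [RHS](AC (1*3*1) (2*(1*3)*(4*5))) /=.
by rewrite !addvv_pchar2 !addr0.
Qed.

Lemma val_pr_even u : u \in even_part g -> vsval (pr u) = u.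
Proof. by move=> u0; rewrite val_pr !B_even_odd // !scale0r !addr0. Qed.

Lemma val_pr_odd u : u \in odd_part g -> vsval (pr u) \in odd_part g.
Proof. by move=> u1; rewrite val_pr !memvD ?memvZ. Qed.

(* On the orthogonal of [x] the projection only changes a vector by a multiple
   of the central vector [x], which no bracket sees. *)
Let br_pr u v : B u x = 0 -> br (vsval (pr u)) v = br u v.
Proof.
by move=> ux; rewrite val_pr ux scale0r addr0 bDl bZl x_central scaler0 addr0.
Qed.

Let br_pr_br u v w : br (vsval (pr (br u v))) w = br (br u v) w.
Proof. exact: br_pr. Qed.

Let br_br_pr u v w : br w (vsval (pr (br u v))) = br w (br u v).
Proof. by rewrite br_sym // br_pr_br br_sym. Qed.

(** The reduction is isomorphic to the quotient by [x] of the orthogonal of [x];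
    the complement [xs] selects a copy of this quotient inside [g]. *)
Definition reduction : superalgebra K := @Superalgebra K a
  (linfun vsval @^-1: even_part g)%VS (linfun vsval @^-1: odd_part g)%VS
  (fun u v : a => pr (br (vsval u) (vsval v))) (fun u : a => pr (sq (vsval u))).

Definition reduction_form (u v : reduction) : K := B (vsval u) (vsval v).
Definition reduction_omega (u v : reduction) : K := om (vsval u) (vsval v).

Lemma reduction_even (u : reduction) :
  (u \in even_part reduction) = (vsval u \in even_part g).
Proof. by rewrite -memv_preim lfunE. Qed.

Lemma reduction_odd (u : reduction) :
  (u \in odd_part reduction) = (vsval u \in odd_part g).
Proof. by rewrite -memv_preim lfunE. Qed.

Lemma reduction_brE (u v : reduction) : br u v = pr (br (vsval u) (vsval v)).
Proof. by []. Qed.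

Lemma reduction_sqE (u : reduction) : sq u = pr (sq (vsval u)).
Proof. by []. Qed.

(** Nested brackets can be computed in [g] and projected once, by [br_br_pr] and
    [br_pr_br]; even vectors, in particular squares, are fixed by the
    projection.  Each axiom is thus the projection of the same axiom in [g]. *)
Lemma reduction_lie : lie_superalgebra reduction.
Proof.
split.
- apply/eqP; rewrite eqEsubv subvf /=; apply/subvP=> u _.
  have [e [o [e0 o1 ue]]] := parity_split lie_g (vsval u).
  rewrite -(pr_val u) ue linearD memv_add ?reduction_even ?reduction_odd //.
    by rewrite val_pr_even.
  exact: val_pr_odd.
- apply/eqP; rewrite -subv0; apply/subvP=> u.
  rewrite memv_cap reduction_even reduction_odd memv0 => /andP[u0 u1].
  by apply/eqP/val_inj/(parity_disjoint lie_g).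
- split=> u c v w; rewrite !reduction_brE !linearP /=.
    by rewrite bDl bZl linearP.
  by rewrite bDr bZr linearP.
- move=> u v; rewrite !reduction_even => u0 v0.
  by rewrite reduction_brE val_pr_even ?(br_even_even lie_g).
- move=> u; rewrite reduction_even reduction_brE => /(br_even_self lie_g)->.
  exact: linear0.
- move=> u v w; rewrite !reduction_even !reduction_brE => u0 v0 w0.
  by rewrite !br_br_pr -!linearD (br_jacobi lie_g) ?linear0.
- move=> u v; rewrite !reduction_even !reduction_odd => u0 v1.
  by rewrite reduction_brE val_pr_odd ?(br_even_odd lie_g).
- move=> u v w; rewrite !reduction_even !reduction_odd !reduction_brE.
  move=> u0 v0 w1.
  by rewrite br_pr_br !br_br_pr -linearB (br_module lie_g).
- by move=> u v _ _; rewrite !reduction_brE br_sym.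
- move=> u; rewrite reduction_odd reduction_even reduction_sqE => u1.
  by rewrite val_pr_even ?(sq_even lie_g).
- move=> c u; rewrite reduction_odd !reduction_sqE => u1.
  by rewrite linearZ (sq_scale lie_g) // linearZ.
- move=> u v; rewrite !reduction_odd !reduction_sqE reduction_brE => u1 v1.
  by rewrite linearD (br_odd_odd lie_g) // !linearB.
- move=> u v; rewrite reduction_odd reduction_sqE !reduction_brE => u1.
  by rewrite val_pr_even ?(sq_even lie_g) // br_br_pr (br_sq lie_g).
Qed.

Lemma reduction_NIS : even_NIS reduction_form.
Proof.
split; last first.
  move=> u v; rewrite reduction_even reduction_odd => u0 v1.
  by have [] := NIS_B.2 _ _ u0 v1.
split.
- split=> u c v w; rewrite /reduction_form linearP /=.
    by rewrite BDl BZl.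
  by rewrite BDr BZr.
- move=> u u_orth; apply: val_inj; apply: (NIS_nondegenerate NIS_B.1) => v.
  by rewrite symB -[B v _]B_pr symB; apply: u_orth.
- move=> u v w; rewrite /reduction_form !reduction_brE B_pr.
  by rewrite [RHS]symB B_pr [RHS]symB invB.
- by move=> u v; apply: symB.
- by move=> u; rewrite reduction_odd => /(NIS_odd_isotropic NIS_B.1).
Qed.

Definition reduction_Delta : 'End(reduction) :=
  linfun (fun u : reduction => pr (Delta (vsval u))).
Definition reduction_D : 'End(reduction) :=
  linfun (fun u : reduction => pr (br xs (vsval u))).

Lemma reduction_DeltaE (u : reduction) :
  reduction_Delta u = pr (Delta (vsval u)).
Proof.
by apply: linfun_linearE => c v w; rewrite !linearP.
Qed.

Lemma reduction_DE (u : reduction) : reduction_D u = pr (br xs (vsval u)).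
Proof.
by apply: linfun_linearE => c v w; rewrite linearP /= bDr bZr linearP.
Qed.

Let Delta_sa := Delta_selfadjoint NIS_B om_g DeltaE.

Let B_Delta_x u : B (Delta u) x = lam * B u x.
Proof. by rewrite Delta_sa Delta_x BZr. Qed.

Let B_Delta_val_x (u : a) : B (Delta (vsval u)) x = 0.
Proof. by rewrite B_Delta_x B_val_x mulr0. Qed.

(* As [x] is an eigenvector, [Delta] preserves the line that the projection
   discards. *)
Let pr_Delta_pr u : B u x = 0 -> pr (Delta (vsval (pr u))) = pr (Delta u).
Proof.
move=> ux; rewrite val_pr ux scale0r addr0 linearD linearZ /= Delta_x /=.
by rewrite linearD /= !linearZ /= pr_x !scaler0 addr0.
Qed.

Lemma reduction_omegaE (u v : reduction) :
  reduction_omega u v = reduction_form (reduction_Delta u) v.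
Proof.
by rewrite /reduction_form reduction_DeltaE B_pr DeltaE.
Qed.

(** If [Delta u] and [Delta v] agree up to a multiple of [x], then so do [u] and
    [v], as [x] is an eigenvector for a nonzero eigenvalue; and a vector of the
    reduction is determined modulo [x]. *)
Lemma reduction_Delta_inj : injective reduction_Delta.
Proof.
move=> u v; rewrite !reduction_DeltaE => /(congr1 vsval).
rewrite !val_pr !B_Delta_val_x !scale0r !addr0 => E.
(* The [x]-components of [Delta u] and [Delta v] differ by [lam * c]. *)
pose c := lam^-1 * (B (Delta (vsval u)) xs + B (Delta (vsval v)) xs).
have uv : vsval u = vsval v + c *: x.
  apply: (Delta_inj NIS_B om_g DeltaE).
  rewrite linearD linearZ /= Delta_x scalerA mulrAC mulVf // mul1r scalerDl.
  by rewrite addrCA -E addrCA addvv_pchar2 addr0.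
by rewrite -[u]pr_val uv linearD linearZ /= pr_x scaler0 addr0 pr_val.
Qed.

(** The multiple of [x] discarded from a bracket is invisible to [om] on the
    orthogonal of [x], because [om x] is [lam] times [B x].  Nondegeneracy comes
    from that of the form and the injectivity of the derivation. *)
Lemma reduction_omega_symplectic :
  closed_one_antisym_ortho_orthogonal reduction_omega.
Proof.
have bilo := om_bilinear om_g.
have om_x u v : om (u + B u xs *: x) v = om u v + B u xs * lam * B x v.
  by rewrite (formDl bilo) (formZl bilo) -(DeltaE x) Delta_x BZl mulrA.
have om_pr u (v : a) : B u x = 0 ->
    om (vsval (pr u)) (vsval v) = om u (vsval v).
  move=> ux; rewrite val_pr ux scale0r addr0 om_x (symB x) B_val_x.
  by rewrite mulr0 addr0.
split.
- split=> u c v w; rewrite /reduction_omega linearP /=.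
    by rewrite (formDl bilo) (formZl bilo).
  by rewrite (formDr bilo) (formZr bilo).
- split=> [u v w|u v].
    by rewrite /reduction_omega !reduction_brE !om_pr // (om_closed om_g).1.
  rewrite reduction_odd /reduction_omega reduction_sqE reduction_brE => u1.
  rewrite val_pr_even ?(sq_even lie_g) // (om_closed om_g).2 //.
  by rewrite ![om (vsval u) _](om_antisymmetric om_g).1 om_pr.
- split=> [u v|u]; first exact: (om_antisymmetric om_g).1.
  by rewrite reduction_even; apply: (om_antisymmetric om_g).2.
- split=> [u v|u u_orth].
    rewrite reduction_even reduction_odd.
    exact: (om_ortho_orthogonal om_g).1.
  apply: reduction_Delta_inj; rewrite linear0.
  apply: (NIS_nondegenerate reduction_NIS.1) => v.
  by rewrite -reduction_omegaE.
Qed.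

Definition reduction_a0 : reduction := pr (sq xs).
Definition reduction_b0 : reduction := pr (Delta xs).
Definition reduction_mu : K := B (Delta xs) xs.

Let D_even := Delta_even lie_g NIS_B om_g DeltaE.
Let Delta_br_g := Delta_br lie_g NIS_B om_g DeltaE.

Let br_xs_xs : br xs xs = 0. Proof. exact: br_odd_self. Qed.

Let vsval_inj (u v : reduction) : vsval u = vsval v -> u = v.
Proof. exact: val_inj. Qed.

(** No projection is needed: [br xs u] is orthogonal to [xs] by invariance, as
    [br xs xs = 0]. *)
Lemma val_reduction_D (u : reduction) :
  vsval (reduction_D u) = br xs (vsval u).
Proof.
rewrite reduction_DE val_pr Bbrx scale0r addr0 symB -invB br_xs_xs.
by rewrite (form0l bilB) scale0r addr0.
Qed.

(** The coefficient of [xs] is [B (Delta xs) x = B xs (Delta x) = lam]. *)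
Lemma Delta_xs :
  Delta xs = lam *: xs + vsval (reduction_b0 : a) + reduction_mu *: x.
Proof.
rewrite {1}[Delta xs]split_val_pr B_Delta_x Bsx mulr1.
by rewrite [LHS](AC (2*1) (3*2*1)).
Qed.

(** Each condition is an identity of [g] evaluated at [xs] and projected: the
    commutator relation and [Delta a0 = D b0] expand [Delta (br xs u)] and
    [Delta (sq xs)] with [Delta_xs]; the square of [D] is the axiom on the
    bracket with [sq xs]. *)
Lemma reduction_D1_data : D1_data reduction_form reduction_omega
  reduction_Delta reduction_D reduction_a0 reduction_b0 lam reduction_mu.
Proof.
split.
- split=> u; rewrite ?reduction_even ?reduction_odd reduction_DeltaE => u0.
    by rewrite val_pr_even D_even.1.
  by rewrite val_pr_odd ?D_even.2.
- split=> [u v _|u].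
    rewrite !reduction_DeltaE !reduction_brE pr_Delta_pr // Delta_br_g.
    rewrite linearD /= br_pr // [br _ (vsval (pr _))]br_sym // br_pr //.
    by rewrite [br _ (vsval u)]br_sym.
  rewrite reduction_odd !reduction_DeltaE reduction_sqE reduction_brE => u1.
  rewrite val_pr_even ?(sq_even lie_g) // (Delta_sq NIS_B om_g DeltaE) //.
  by rewrite br_pr.
- exact/inj_end_bij/reduction_Delta_inj.
- exact: reduction_omegaE.
- split=> u; rewrite !(reduction_even, reduction_odd) val_reduction_D => u0.
    by rewrite (br_odd_even lie_g) // (br_even_odd lie_g).
  rewrite (br_odd_odd lie_g) // !memvB // (sq_even lie_g) //.
  exact: memvD.
- split=> [u v _|u].
    rewrite reduction_DE !reduction_brE !val_reduction_D br_br_pr -linearD /=.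
    by rewrite (br_leibniz lie_g).
  rewrite reduction_odd reduction_DE reduction_sqE reduction_brE => u1.
  rewrite val_reduction_D val_pr_even ?(sq_even lie_g) // br_sym //.
  by rewrite (br_sq lie_g) // br_sym // (br_sym lie_g xs).
- move=> u v; rewrite /reduction_form !val_reduction_D.
  by rewrite -invB (br_sym lie_g xs).
- by rewrite reduction_even val_pr_even (sq_even lie_g).
- move=> u; apply: vsval_inj; rewrite !val_reduction_D reduction_brE.
  rewrite (val_pr_even (sq_even lie_g xs_odd)) (br_sq lie_g) //.
  by rewrite -!val_reduction_D pr_val.
- apply: vsval_inj; rewrite val_reduction_D val_pr_even ?(sq_even lie_g) //.
  by rewrite (br_sym lie_g xs) (br_sq lie_g) // br_xs_xs (br0r lie_g).
- exact: lam_neq0.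
- by rewrite reduction_odd val_pr_odd // D_even.2.
- move=> u.
  have -> : reduction_D (reduction_Delta u) = pr (br xs (Delta (vsval u))).
    by rewrite reduction_DE reduction_DeltaE br_sym // br_pr // br_sym.
  rewrite reduction_DeltaE val_reduction_D Delta_br_g linearD /= addrK Delta_xs.
  by rewrite !bDl !bZl x_central scaler0 addr0 linearD linearZ /= -reduction_DE.
- rewrite reduction_DeltaE (val_pr_even (sq_even lie_g xs_odd)).
  rewrite (Delta_sq NIS_B om_g DeltaE) // Delta_xs reduction_DE.
  by rewrite !bDl !bZl br_xs_xs x_central !scaler0 addr0 add0r br_sym.
Qed.

(** * Recovering the algebra from its reduction *)

Let h := D1_extension reduction_form reduction_D reduction_a0.

Definition split_map u : h := (B u xs : K^o, pr u, B u x : K^o).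

Lemma split_map_linear : linear split_map.
Proof.
move=> c u v; rewrite /split_map !BDl !BZl linearP.
by congr (_, _, _).
Qed.

HB.instance Definition _ :=
  GRing.isLinear.Build K g h *:%R split_map split_map_linear.

Definition unsplit (p : h) : g :=
  let: (r, u, t) := p in r *: x + vsval u + t *: xs.

Lemma split_mapK : cancel split_map unsplit.
Proof. by move=> u; rewrite /= -split_val_pr. Qed.

Lemma unsplitK : cancel unsplit split_map.
Proof.
case=> [[r u] t]; rewrite /split_map /= !BDl !BZl Bxx Bss Bsx B_x_xs.
rewrite B_val_x B_val_xs !mulr0 !mulr1 !addr0 !add0r /=.
by rewrite !linearD /= !linearZ /= pr_x pr_xs !scaler0 addr0 add0r pr_val.
Qed.

(** The [x]-component of [br u v] is [B (br u v) xs], which invariance turns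
    into the cocycle [B (D u) v] of the extension. *)
Lemma split_map_br u v : split_map (br u v) = br (split_map u) (split_map v).
Proof.
have brE : br u v = br (vsval (pr u)) (vsval (pr v)) +
    B u x *: br xs (vsval (pr v)) + B v x *: br xs (vsval (pr u)).
  rewrite {1}[u]split_val_pr {1}[v]split_val_pr !bDl !bDr !bZl !bZr.
  rewrite !br_x !x_central br_xs_xs !scaler0 !addr0 !add0r (br_sym lie_g _ xs).
  by rewrite addrAC.
congr (_, _, _); last exact: Bbrx.
  rewrite brE !BDl !BZl -!val_reduction_D !B_val_xs !mulr0 !addr0.
  rewrite /reduction_form val_reduction_D (br_sym lie_g xs) !invB.
  by rewrite (br_sym lie_g _ xs).
by rewrite brE !linearD !linearZ /= !reduction_DE.
Qed.

(** [sq] is additive up to brackets, [sq x = 0] and [x] is central: only [sq] of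
    the component in the reduction, [sq xs] and one bracket with [xs] remain. *)
Lemma split_map_sq u : u \in odd_part g -> split_map (sq u) = sq (split_map u).
Proof.
move=> u1; have sq0 := sq_even lie_g u1.
congr (_, _, _); try by rewrite B_even_odd.
have p1 := val_pr_odd u1.
rewrite {1}[u]split_val_pr !(sqD lie_g) ?memvD ?memvZ //.
rewrite !(sq_scale lie_g) // sqx bDl !bZl !bZr !x_central.
rewrite !scaler0 !(addr0, add0r) (br_sym lie_g _ xs).
by rewrite !linearD !linearZ /= !reduction_DE.
Qed.

Lemma split_map_form u v :
  D1_form (split_map u) (split_map v) = B u v.
Proof.
rewrite /D1_form /= /reduction_form B_pr {4}[v]split_val_pr !BDr !BZr.
by rewrite [RHS](AC (2*1) (2*3*1)) /= [B u xs * _]mulrC [B u x * _]mulrC.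
Qed.

(** Selfadjointness gives the outer components of [Delta u], from the values of
    [Delta] at [x] and [xs]. *)
Lemma split_map_Delta u :
  @D1_Delta _ _ reduction_form reduction_Delta reduction_D reduction_a0
    reduction_b0 lam reduction_mu (split_map u) = split_map (Delta u).
Proof.
have BDu : B (Delta u) xs =
    lam * B u xs + reduction_form (pr u) reduction_b0 + reduction_mu * B u x.
  by rewrite Delta_sa Delta_xs !BDr !BZr /reduction_form B_pr.
congr (_, _, _); rewrite ?B_Delta_x //.
rewrite [in RHS](split_val_pr u) !linearD !linearZ /= Delta_x linearZ /= pr_x.
by rewrite !scaler0 add0r reduction_DeltaE.
Qed.

Lemma split_map_even u : (split_map u \in even_part h) = (u \in even_part g).
Proof.
have -> : (split_map u \in even_part h) =
    [&& B u xs == 0, pr u \in even_part reduction & B u x == 0].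
  exact: mem_D1_even.
rewrite reduction_even.
apply/and3P/idP => [[/eqP r0 u0 /eqP t0]|u0].
  by rewrite [u]split_val_pr r0 t0 !scale0r add0r addr0.
by rewrite !B_even_odd // eqxx val_pr_even.
Qed.

Lemma split_map_odd u : (split_map u \in odd_part h) = (u \in odd_part g).
Proof.
have -> : (split_map u \in odd_part h) = (pr u \in odd_part reduction).
  exact: mem_D1_odd.
rewrite reduction_odd.
apply/idP/idP => [u1|]; last exact: val_pr_odd.
by rewrite [u]split_val_pr !memvD ?memvZ.
Qed.

Lemma split_map_iso : isometric_isomorphism B om
  (@D1_form K reduction reduction_form reduction_D reduction_a0)
  (@D1_omega K reduction reduction_form reduction_Delta reduction_D
     reduction_a0 reduction_b0 lam reduction_mu) (linfun split_map).
Proof.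
split.
- exists unsplit => u; rewrite lfunE; [exact: split_mapK | exact: unsplitK].
- apply/vspaceP=> p; apply/memv_imgP/idP => [[u u0 ->]|p0].
    by rewrite lfunE split_map_even.
  exists (unsplit p); rewrite ?lfunE /= ?unsplitK //.
  by rewrite -split_map_even unsplitK.
- apply/vspaceP=> p; apply/memv_imgP/idP => [[u u1 ->]|p1].
    by rewrite lfunE split_map_odd.
  exists (unsplit p); rewrite ?lfunE /= ?unsplitK //.
  by rewrite -split_map_odd unsplitK.
- by move=> u v; rewrite !lfunE; apply: split_map_br.
- by move=> u u1; rewrite !lfunE; apply: split_map_sq.
- by move=> u v; rewrite !lfunE; apply: split_map_form.
- move=> u v; rewrite !lfunE /D1_omega split_map_Delta -DeltaE.
  exact: split_map_form.
Qed.

End Reduction.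

End CharacteristicTwo.

(** * Existence of the extension data *)

Theorem theorem4p1p12 (K : closedFieldType) (charK : 2%N \in [pchar K])
    (g : superalgebra K) (Bg omg : g -> g -> K)
    (lie_g : lie_superalgebra g)
    (NIS_g : even_NIS Bg)
    (irr_g : irreducible Bg)
    (om_g : closed_one_antisym_ortho_orthogonal omg)
    (z1_neq0 : exists x : g, [/\ x \in odd_part g, central x & x != 0]) :
  exists (a : superalgebra K) (Ba oma : a -> a -> K),
    [/\ lie_superalgebra a,
        even_NIS Ba,
        closed_one_antisym_ortho_orthogonal oma
      & is_D1_extension_of Bg omg Ba oma].
Proof.
have bilB := NIS_bilinear NIS_g.1.
have [Delta DeltaE] := nondegenerate_representation bilB (om_bilinear om_g)
  (NIS_nondegenerate NIS_g.1).
have [Z ZP] := odd_center_vspace lie_g.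
have Z0 : Z != 0%VS.
  have [z [z1 zc z0]] := z1_neq0; apply: contraNneq z0 => Z0.
  by rewrite -memv0 -Z0; apply/ZP.
have DZ z : z \in Z -> Delta z \in Z.
  move=> /ZP[z1 zc]; apply/ZP; split.
    exact: (Delta_even charK lie_g NIS_g om_g DeltaE).2.
  move=> v; have := Delta_br charK lie_g NIS_g om_g DeltaE z v.
  by rewrite !zc linear0 addr0.
have [x /andP[/ZP[x_odd x_central] x0] [lam Delta_x]] :=
  stable_eigenvector Z0 DZ.
have lam0 : lam != 0.
  apply: contra_neq x0 => lam0; apply: (Delta_inj NIS_g om_g DeltaE).
  by rewrite Delta_x lam0 scale0r linear0.
have [o o1 Bo] := odd_partner lie_g NIS_g x_odd x0.
pose xs := (Bg x o)^-1 *: o.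
have xs_odd : xs \in odd_part g by rewrite memvZ.
have B_x_xs : Bg x xs = 1 by rewrite (formZr bilB) mulVf.
exists (reduction Bg x xs), (@reduction_form _ _ Bg x xs).
exists (@reduction_omega _ _ Bg omg x xs); split.
- exact: reduction_lie.
- exact: reduction_NIS.
- exact: (reduction_omega_symplectic charK lie_g NIS_g om_g DeltaE x_odd
    x_central Delta_x).
have data := reduction_D1_data charK lie_g NIS_g om_g DeltaE x_odd x_central
  Delta_x lam0 xs_odd B_x_xs.
have iso := split_map_iso charK lie_g NIS_g om_g DeltaE x_odd x_central
  Delta_x xs_odd B_x_xs.
by do 6 eexists; split; [exact: data | eexists; exact: iso].
Qed.
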